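(* Let $C^\infty[0,1]$ be the space of infinitely differentiable real-valued functions on $[0,1]$, with the topology defined by the collection of norms $\|x\|_k=\max_{j\le k}\max_{t\in[0,1]}|x^{(j)}(t)|$, $k=0,1,2,\dots$, and let $Y$ be a real linear topological space. Then every bounded-differentiable germ at $0\in C^\infty[0,1]$ into $Y$ has a global bounded-differentiable representative, and every compact-differentiable germ at $0\in C^\infty[0,1]$ into $Y$ has a global compact-differentiable representative.
   Context: Differentiability. A map $f$ from a neighborhood of $x$ in a linear topological space $X$ to a linear topological space $Y$ is differentiable at $x$ if there is a continuous linear $A:X\to Y$ such that, with $r(h)=f(x+h)-f(x)-Ah$: (i) bounded differentiability: for every bounded set $S\subset X$ (bounded in the sense of linear topological spaces), $r(th)/t\to 0$ as $t\to 0$ ($t\in\mathbb{R}$), uniformly in $h\in S$; (ii) compact (Hadamard) differentiability: $f(x+t_nh_n)-f(x)=t_nAh+o(t_n)$ whenever $t_n\to 0$ in $\mathbb{R}$ and $h_n\to h$ in $X$. A map is differentiable on a set if it is differentiable at every point of it. Germs. A germ at $0\in X$ into $Y$ is an equivalence class of maps into $Y$ defined on neighborhoods of $0$, any two of which coincide on some neighborhood of $0$; its elements are called representatives. A germ is differentiable (in a given sense) if it has a representative differentiable in that sense on a neighborhood of $0$. A global differentiable representative is a representative defined and differentiable (in that sense) on all of $X$. *)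

(* Defs.v *)
From HB Require Import structures.
From mathcomp Require Import all_boot all_order all_algebra.
From mathcomp Require Import lra.
From mathcomp Require Import all_classical all_reals all_analysis.
Set Implicit Arguments.
Unset Strict Implicit.
Unset Printing Implicit Defensive.
Import Order.TTheory GRing.Theory Num.Theory.
Import numFieldNormedType.Exports.
Local Open Scope classical_set_scope.
Local Open Scope ring_scope.

Section Differentiability.
Context {R : realType} {X Y : topologicalLmodType R}.
Implicit Types (S D : set X) (f : X -> Y) (x : X).

(* The library's [bounded_set] needs a norm. *)
Definition tvs_bounded S : Prop :=
  forall V : set X, nbhs 0 V ->
    exists r : R, 0 < r /\
      forall l : R, r <= `|l| -> S `<=` [set l *: v | v in V].

(* A map defined on [D] is a total function of which only the values on [D]
   matter: both conditions below are about limits at a point of which [D] is a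
   neighborhood. *)
Definition bounded_differentiable_at D f x : Prop :=
  nbhs x D /\
  exists A : {linear X -> Y}, continuous A /\
    forall S, tvs_bounded S -> forall V : set Y, nbhs 0 V ->
      \forall t \near (0 : R)^', forall h, S h ->
        V (t^-1 *: (f (x + t *: h) - f x - A (t *: h))).

(* Since [0^-1 = 0], nothing is required at the indices where [t_ n = 0]; there
   the remainder is zero. *)
Definition compact_differentiable_at D f x : Prop :=
  nbhs x D /\
  exists A : {linear X -> Y}, continuous A /\
    forall (t_ : nat -> R) (h_ : nat -> X) (h : X),
      t_ n @[n --> \oo] --> (0 : R) -> h_ n @[n --> \oo] --> h ->
      (t_ n)^-1 *: (f (x + t_ n *: h_ n) - f x - t_ n *: A h)
        @[n --> \oo] --> (0 : Y).

End Differentiability.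

Section Germs.
Context {R : realType} (X Y : topologicalLmodType R).

Record local_map := LocalMap {
  dom : set X;
  lfun :> X -> Y;
  dom_nbhs : nbhs 0 dom }.

Definition germ_eq (f g : local_map) : Prop :=
  \forall x \near (0 : X), [/\ dom f x, dom g x & f x = g x].

Record germ := Germ {
  representatives : set local_map;
  germ_class : exists f, representatives = [set g | germ_eq f g] }.

Definition differentiable_germ (diff_at : set X -> (X -> Y) -> X -> Prop)
    (g : germ) : Prop :=
  exists2 f, representatives g f & \forall x \near (0 : X), diff_at (dom f) f x.

Definition has_global_representative
    (diff_at : set X -> (X -> Y) -> X -> Prop) (g : germ) : Prop :=
  exists f, [/\ representatives g f, dom f = setT &
    forall x, diff_at setT f x].

End Germs.

Section SmoothFunctions.
Context {R : realType}.

Definition unit_interval : set R := `[0, 1]%classic.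
Implicit Types (f g : unit_interval -> R) (s t : unit_interval).

(* The filter [t^'] is that of [unit_interval], so that the derivatives at the
   endpoints are one-sided. *)
Definition diff_quot f t s : R := (f s - f t) / (set_val s - set_val t).

Definition deriv01 f t : R := lim (diff_quot f t s @[s --> t^']).

Definition derivn01 n f : unit_interval -> R := iter n deriv01 f.

Definition smooth01 f : Prop :=
  forall n t, cvg (diff_quot (derivn01 n f) t s @[s --> t^']).

(* For the continuous [f] to which this is applied, the supremum is a maximum. *)
Definition sup_norm01 f : R := sup (range (fun t => `|f t|)).

End SmoothFunctions.
Arguments unit_interval R : clear implicits.

Section SmoothTheory.
Context {R : realType}.
Implicit Types (f g : unit_interval R -> R) (s t : unit_interval R).

Lemma nbhs01P t (A : set (unit_interval R)) :
  nbhs t A <->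
  exists2 e : R, 0 < e &
    forall s, `|set_val t - set_val s| < e -> A s.
Proof.
split=> [/nbhs_ballP|] [e e0 eA]; last apply/nbhs_ballP; exists e => //.
Qed.

Lemma in01 (x : R) : 0 <= x -> x <= 1 -> x \in unit_interval R.
Proof. by move=> x0 x1; rewrite inE /unit_interval /= in_itv /= x0 x1. Qed.

Lemma point01 (x : R) : 0 <= x -> x <= 1 ->
  exists s : unit_interval R, set_val s = x.
Proof. by move=> x0 x1; exists (SigSub (in01 x0 x1)). Qed.

#[global] Instance dnbhs01_proper t : ProperFilter t^'.
Proof.
apply: Build_ProperFilter_ex => A /nbhs01P[e e0 eA].
have /andP[t0 t1] : 0 <= set_val t <= 1.
  have : unit_interval R (set_val t) by exact: set_valP.
  by rewrite /unit_interval /= in_itv.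
pose d := Num.min (e / 2) 2^-1.
have d0 : 0 < d by rewrite lt_min divr_gt0//= invr_gt0 ltr0n.
have de : d < e by rewrite gt_min ltr_pdivrMr// ltr_pMr// ltr1n.
have d2 : d <= 2^-1 by rewrite ge_min lexx orbT.
have twoV : (2^-1 + 2^-1 = 1 :> R) by rewrite [RHS]splitr mul1r.
have dn0 : d != 0 by rewrite gt_eqF.
case: (leP (set_val t) 2^-1) => th.
- have [s sE] : exists s : unit_interval R, set_val s = set_val t + d.
    by apply: point01; [rewrite addr_ge0// ltW|rewrite -twoV lerD].
  exists s; apply: eA; first by rewrite sE opprD addNKr normrN gtr0_norm.
  apply/eqP => /(congr1 set_val) /eqP.
  by rewrite sE -subr_eq0 addrAC subrr add0r (negbTE dn0).
- have [s sE] : exists s : unit_interval R, set_val s = set_val t - d.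
    apply: point01; first by rewrite subr_ge0 (le_trans d2)// ltW.
    by rewrite (le_trans _ t1)// gerBl ltW.
  exists s; apply: eA; first by rewrite sE opprB addrC subrK gtr0_norm.
  apply/eqP => /(congr1 set_val) /eqP.
  by rewrite sE -subr_eq0 addrAC subrr add0r oppr_eq0 (negbTE dn0).
Qed.

Lemma diff_quotZD a f g t :
  diff_quot (a *: f + g) t = (fun s => a * diff_quot f t s + diff_quot g t s).
Proof.
apply/funext => s; rewrite /diff_quot mulrA -mulrDl; congr (_ / _).
by rewrite !fctE /GRing.scale /= mulrBr opprD addrACA.
Qed.

Lemma derivn01ZD a f g n : smooth01 f -> smooth01 g ->
  derivn01 n (a *: f + g) = a *: derivn01 n f + derivn01 n g.
Proof.
move=> sf sg; elim: n => // n; rewrite /derivn01 !iterS => ->.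
apply/funext => t; rewrite {1}/deriv01 diff_quotZD; apply/cvg_lim => //.
by apply: cvgD; [apply: cvgMl_tmp; exact: (sf n t)|exact: (sg n t)].
Qed.

Lemma smooth01ZD a f g : smooth01 f -> smooth01 g -> smooth01 (a *: f + g).
Proof.
move=> sf sg n t; rewrite derivn01ZD// diff_quotZD.
by apply: is_cvgD; [apply: is_cvgM; [exact: is_cvg_cst|exact: sf]|exact: sg].
Qed.

Lemma derivn01_0 n : derivn01 n (0 : unit_interval R -> R) = 0.
Proof.
elim: n => // n; rewrite /derivn01 iterS => ->.
apply/funext => t; rewrite /deriv01.
rewrite (_ : diff_quot 0 t = cst 0); first by apply/cvg_lim => //; exact: cvg_cst.
by apply/funext => s; rewrite /diff_quot subrr mul0r.
Qed.

Lemma smooth01_0 : smooth01 (0 : unit_interval R -> R).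
Proof.
move=> n t; rewrite derivn01_0 (_ : diff_quot 0 t = cst 0).
  exact: is_cvg_cst.
by apply/funext => s; rewrite /diff_quot subrr mul0r.
Qed.

Lemma cvg_diff_quot_continuous f :
  (forall t, cvg (diff_quot f t s @[s --> t^'])) -> continuous f.
Proof.
move=> df t; rewrite /continuous_at.
suff ft : f s @[s --> t^'] --> f t.
  move=> A fA; rewrite dnbhsE; split; first exact: ft.
  by apply/principal_filterP => /=; exact: nbhs_singleton.
have vt : set_val s - set_val t @[s --> t^'] --> 0.
  rewrite -(subrr (set_val t)); apply: cvgB; last exact: cvg_cst.
  apply: cvg_trans; last exact: (@initial_continuous _ _ set_val t).
  by apply: cvg_app; exact: nbhs_dnbhs.
have : f t + diff_quot f t s * (set_val s - set_val t) @[s --> t^'] --> f t.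
  rewrite -[X in _ --> X]addr0.
  rewrite -(mulr0 (lim (diff_quot f t s @[s --> t^']))).
  by apply: cvgD; [exact: cvg_cst|apply: cvgM => //; exact: df].
apply: cvg_trans; apply: near_eq_cvg; near=> s.
have st : s != t by near: s; exact: nbhs_dnbhs_neq.
rewrite /diff_quot divfK; first by rewrite addrC subrK.
by rewrite subr_eq0; apply: contra_neq st => /val_inj.
Unshelve. all: by end_near. Qed.

Lemma compact01 : compact [set: unit_interval R].
Proof.
pose p (x : R) := Num.max 0 (Num.min x 1).
have pI x : p x \in unit_interval R.
  apply: in01; rewrite /p ?le_max ?lexx// ge_max ler01/= ge_min lexx.
  by rewrite orbT.
pose q (x : R) : unit_interval R := SigSub (pI x).
have -> : [set: unit_interval R] = q @` `[0, 1].
  apply/seteqP; split=> // t _.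
  have /= := set_valP t; rewrite /unit_interval /= in_itv /= => /andP[t0 t1].
  exists (set_val t); first by rewrite /= in_itv /= t0.
  apply: val_inj => /=; rewrite /p.
  by rewrite (min_idPl t1) (max_idPr t0).
apply: continuous_compact; last exact: segment_compact.
apply: continuous_subspaceT => x A /nbhs01P[e e0 eA].
apply/nbhs_ballP; exists e => // y xy; apply: eA.
apply: le_lt_trans xy; rewrite set_valE /= /p.
by case: (leP x 1) => ?; case: (leP y 1) => ?; rewrite ?(max_idPr ler01);
  case: (leP 0 x) => ?; case: (leP 0 y) => ?;
  rewrite ler_norml; case: (ger0P (x - y)) => ?; lra.
Qed.

Lemma smooth01_continuous f n : smooth01 f -> continuous (derivn01 n f).
Proof. by move=> sf; apply: cvg_diff_quot_continuous; exact: sf. Qed.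

Lemma smooth01_has_sup f n : smooth01 f ->
  has_sup (range (fun t => `|derivn01 n f t|)).
Proof.
move=> sf; split.
  have [t _] := point01 (lexx 0) (@ler01 R).
  by exists `|derivn01 n f t|, t.
have : compact (derivn01 n f @` setT).
  apply: continuous_compact; last exact: compact01.
  exact/continuous_subspaceT/smooth01_continuous.
move=> /compact_bounded[M [_ /(_ (M + 1))]]; rewrite ltrDl ltr01 => /(_ isT) fM.
by exists (M + 1) => _ [t _ <-]; apply: fM; exists t.
Qed.

Lemma sup_norm01_ge f n t : smooth01 f ->
  `|derivn01 n f t| <= sup_norm01 (derivn01 n f).
Proof. by move=> sf; apply: ub_le_sup; [case: (smooth01_has_sup n sf)|exists t]. Qed.

Lemma sup_norm01_le f n (M : R) : smooth01 f ->
  (forall t, `|derivn01 n f t| <= M) -> sup_norm01 (derivn01 n f) <= M.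
Proof.
move=> sf fM; apply: ge_sup; first by case: (smooth01_has_sup n sf).
by move=> _ [t _ <-].
Qed.

Lemma sup_norm01_ge0 f n : smooth01 f -> 0 <= sup_norm01 (derivn01 n f).
Proof.
have [t _] := point01 (lexx 0) (@ler01 R).
by move=> sf; apply: le_trans (sup_norm01_ge n t sf).
Qed.

Definition smooth01_pred : {pred unit_interval R -> R} :=
  [pred f : unit_interval R -> R | `[< smooth01 f >]].

Lemma smooth01_predP f : reflect (smooth01 f) (f \in smooth01_pred).
Proof. exact: asboolP. Qed.

Lemma smooth01_submod_closed : submod_closed smooth01_pred.
Proof.
split; first exact/smooth01_predP/smooth01_0.
move=> a f g /smooth01_predP sf /smooth01_predP sg.
exact/smooth01_predP/smooth01ZD.
Qed.

End SmoothTheory.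

HB.instance Definition _ (R : realType) :=
  GRing.isSubmodClosed.Build R (unit_interval R -> R) smooth01_pred
    smooth01_submod_closed.

Record Cinf01 (R : realType) := MkCinf01 {
  Cinf01_fun :> unit_interval R -> R;
  Cinf01_subproof : Cinf01_fun \in smooth01_pred }.

HB.instance Definition _ (R : realType) := [isSub for @Cinf01_fun R].
HB.instance Definition _ (R : realType) := [Choice of Cinf01 R by <:].
HB.instance Definition _ (R : realType) :=
  [SubChoice_isSubLmodule of Cinf01 R by <:].

Section Cinf01Topology.
Context {R : realType}.
Implicit Types (x y z : Cinf01 R) (k : nat).

Lemma Cinf01P x : smooth01 x.
Proof. exact/smooth01_predP/Cinf01_subproof. Qed.
Arguments Cinf01P x : clear implicits.

Definition Cnorm k x : R :=
  \big[Num.max/0]_(j < k.+1) sup_norm01 (derivn01 j x).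

Definition Cinf01_nbhs x : set_system (Cinf01 R) :=
  [set U | exists (K : seq nat) (e : R), 0 < e /\
    [set y | forall k, k \in K -> Cnorm k (y - x) < e] `<=` U].

HB.instance Definition _ := hasNbhs.Build (Cinf01 R) Cinf01_nbhs.

Lemma Cnorm_ge0 k x : 0 <= Cnorm k x.
Proof. exact: bigmax_ge_id. Qed.

Lemma derivn01_le_Cnorm k (j : 'I_k.+1) x t : `|derivn01 j x t| <= Cnorm k x.
Proof.
apply: (le_trans (sup_norm01_ge j t (Cinf01P x))).
exact: (le_bigmax _ (fun i : 'I_k.+1 => sup_norm01 (derivn01 i x))).
Qed.

Lemma CnormZD k a x y : Cnorm k (a *: x + y) <= `|a| * Cnorm k x + Cnorm k y.
Proof.
apply: bigmax_le => [|j _].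
  by rewrite addr_ge0 ?mulr_ge0 ?Cnorm_ge0.
apply: sup_norm01_le => [|t]; first exact: Cinf01P.
rewrite (_ : Cinf01_fun (a *: x + y) = a *: (x : _ -> _) + y)//.
rewrite derivn01ZD; [|exact: Cinf01P..].
rewrite !fctE; apply: (le_trans (ler_normD _ _)); rewrite normrM lerD//.
  by apply: ler_wpM2l => //; exact: derivn01_le_Cnorm.
exact: derivn01_le_Cnorm.
Qed.

Lemma Cnorm0 k : Cnorm k 0 = 0.
Proof.
apply/eqP; rewrite eq_le Cnorm_ge0 andbT.
apply: bigmax_le => // j _; apply: sup_norm01_le => [|t]; first exact: Cinf01P.
by rewrite derivn01_0 normr0.
Qed.

Lemma CnormD k x y : Cnorm k (x + y) <= Cnorm k x + Cnorm k y.
Proof. by have := CnormZD k 1 x y; rewrite scale1r normr1 mul1r. Qed.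

Lemma CnormZ k a x : Cnorm k (a *: x) <= `|a| * Cnorm k x.
Proof. by have := CnormZD k a x 0; rewrite Cnorm0 !addr0. Qed.

Let nbhsCE x : nbhs x = Cinf01_nbhs x. Proof. by []. Qed.

Let Cinf01_nbhs_filter x : ProperFilter (nbhs x).
Proof.
rewrite nbhsCE; apply: Build_ProperFilter_ex.
  move=> U [K [e [e0]]] /(_ x) KU; exists x; apply: KU => k _.
  by rewrite subrr Cnorm0.
split.
- by exists [::], 1.
- move=> U V [K [e [e0 KU]]] [L [d [d0 LV]]].
  exists (K ++ L), (Num.min e d); split; first by rewrite lt_min e0.
  move=> y /= KLy; split; [apply: KU|apply: LV] => k kK.
    by have := KLy k; rewrite mem_cat kK lt_min => /(_ isT)/andP[].
  by have := KLy k; rewrite mem_cat kK orbT lt_min => /(_ isT)/andP[].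
- move=> U V UV [K [e [e0 KU]]]; exists K, e; split => //.
  exact: subset_trans UV.
Qed.

Let Cinf01_nbhs_singleton x (U : set (Cinf01 R)) : nbhs x U -> U x.
Proof. by move=> [K [e [e0 KU]]]; apply: KU => k _; rewrite subrr Cnorm0. Qed.

Let Cinf01_nbhs_nbhs x (U : set (Cinf01 R)) : nbhs x U -> nbhs x (nbhs^~ U).
Proof.
move=> [K [e [e0 KU]]]; exists K, (e / 2); split; first exact: divr_gt0.
move=> y /= xy; exists K, (e / 2); split; first exact: divr_gt0.
move=> z /= yz; apply: KU => k kK.
rewrite -(subrK y z) -addrA (le_lt_trans (CnormD _ _ _))// [e]splitr.
by rewrite ltrD// ?xy ?yz.
Qed.

HB.instance Definition _ := Nbhs_isNbhsTopological.Build (Cinf01 R)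
  Cinf01_nbhs_filter Cinf01_nbhs_singleton Cinf01_nbhs_nbhs.

Let Cinf01_add_continuous : continuous (fun p : Cinf01 R * Cinf01 R => p.1 + p.2).
Proof.
move=> [x y] U [K [e [e0 KU]]]; rewrite nbhs_simpl /=.
pose B z : set (Cinf01 R) := [set w | forall k, k \in K -> Cnorm k (w - z) < e / 2].
exists (B x, B y).
  by split; exists K, (e / 2); split => //; exact: divr_gt0.
move=> [a b] /= [xa yb]; apply: KU => k kK /=.
rewrite opprD addrACA (le_lt_trans (CnormD _ _ _))// [e]splitr.
by rewrite ltrD// ?xa ?yb.
Qed.

Let Cinf01_scale_continuous :
  continuous (fun p : R^o * Cinf01 R => p.1 *: p.2).
Proof.
move=> [a x] U [K [e [e0 KU]]]; rewrite nbhs_simpl /=.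
pose M := 1 + \sum_(k <- K) Cnorm k x.
have KM k : k \in K -> Cnorm k x < M.
  move=> kK; rewrite /M (big_rem k)//= addrA (addrC 1) -addrA ltrDl.
  by rewrite ltr_pwDl// sumr_ge0// => i _; exact: Cnorm_ge0.
have M0 : 0 < M by rewrite ltr_pwDl// sumr_ge0// => i _; exact: Cnorm_ge0.
pose N := `|a| + 1; have N0 : 0 < N by rewrite ltr_wpDl.
pose d := Num.min 1 (e / 2 / M).
have d0 : 0 < d by rewrite lt_min ltr01 !divr_gt0.
pose B : set (Cinf01 R) := [set w | forall k, k \in K -> Cnorm k (w - x) < e / 2 / N].
exists (ball (a : R^o) d, B).
  split; first exact: nbhsx_ballx.
  by exists K, (e / 2 / N); split => //; rewrite !divr_gt0.
move=> [b y] /= [ab xy]; apply: KU => k kK /=.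
have -> : b *: y - a *: x = b *: (y - x) + (b - a) *: x.
  by rewrite scalerBr scalerBl addrA subrK.
have ab' : `|b - a| < d by rewrite distrC.
have bN : `|b| <= N.
  rewrite -(subrK a b) (le_trans (ler_normD _ _))// addrC lerD2l.
  by apply: ltW; apply: lt_le_trans ab' _; rewrite ge_min lexx.
rewrite (le_lt_trans (CnormD _ _ _))// [e]splitr ltrD//.
  apply: le_lt_trans (CnormZ _ _ _) _.
  apply: (@le_lt_trans _ _ (N * Cnorm k (y - x))).
    by rewrite ler_wpM2r// Cnorm_ge0.
  by rewrite mulrC -ltr_pdivlMr// xy.
apply: le_lt_trans (CnormZ _ _ _) _.
apply: (@le_lt_trans _ _ (`|b - a| * M)); first by rewrite ler_wpM2l// ltW// KM.
rewrite -ltr_pdivlMr//; apply: lt_le_trans ab' _.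
by rewrite ge_min lexx orbT.
Qed.

HB.instance Definition _ := PreTopologicalNmodule_isTopologicalNmodule.Build
  (Cinf01 R) Cinf01_add_continuous.
HB.instance Definition _ := TopologicalNmodule_isTopologicalLmodule.Build
  R (Cinf01 R) Cinf01_scale_continuous.

End Cinf01Topology.
Arguments Cinf01P {R} x.

(* Main.v *)
Require Import Defs.
From HB Require Import structures.
From mathcomp Require Import all_boot all_order all_algebra.
From mathcomp Require Import all_classical all_reals all_analysis.
From mathcomp Require Import ring lra.
Set Implicit Arguments.
Unset Strict Implicit.
Unset Printing Implicit Defensive.
Import Order.TTheory GRing.Theory Num.Theory.
Import numFieldNormedType.Exports.
Local Open Scope classical_set_scope.
Local Open Scope ring_scope.

(** Both parts follow from the existence of differentiable bump functions on
    [Cinf01 R]: if [f] represents a germ and is differentiable on a neighborhood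
    [U] of [0], and [phi : Cinf01 R -> R] is differentiable, equal to [1] near
    [0], and zero near every point outside [U], then [phi *: f] represents the
    same germ and is differentiable everywhere: by the Leibniz rule at the
    points of [U], and because it vanishes locally at the others
    ([germ_extension]).

    The two notions of differentiability are handled by one argument.  Each says
    that the rescaled remainder [t^-1 *: (f (x + t *: h) - f x - A (t *: h))]
    tends to [0] along certain filters on the pairs [(t, h)]: the products of
    the punctured neighborhoods of [0] with a bounded set, or the images of
    [\oo] under a sequence [(t_ n, h_ n)] with [t_ n --> 0] and [h_ n]
    convergent.  All that the calculus needs from such a filter is that [t]
    tends to [0] and that [h] is bounded, in the sense that [c *: h] tends to
    [0] for all scalars [c] that do ([vanishing_filter]).

    The bump functions come from continuous quadratic forms
    ([bumps_of_quadratic]).  Sup norms are not differentiable, but the sup norm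
    of [x] is bounded by its Sobolev norm of order one ([sobolev01]), so the
    balls of the norms [Cnorm m] contain neighborhoods [{q < d}] of [0], with
    [q] the sum over [j <= m + 1] of the squared L2 norms of the derivatives
    [x^(j)], a quadratic form that is continuous for [Cnorm m.+1].  Composing
    [q] with a cutoff function of one real variable gives the bump. *)

(** * Limits in topological modules *)

Lemma eq_cvg_imp (T : Type) (U : nbhsType) (F : set_system T) (f g : T -> U)
    (l : U) : f =1 g -> f p @[p --> F] --> l -> g p @[p --> F] --> l.
Proof. by move=> /funext ->. Qed.

Section TopologicalLmodule.
Context {R : realType} {Y : topologicalLmodType R} {T : Type}.
Context (F : set_system T) (FF : Filter F).
Implicit Types (f g : T -> Y) (c : T -> R).

Lemma tlmod_cvgD f g (a b : Y) :
  f p @[p --> F] --> a -> g p @[p --> F] --> b ->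
  f p + g p @[p --> F] --> a + b.
Proof. by apply: continuous2_cvg; exact: (@add_continuous Y (a, b)). Qed.

Lemma tlmod_cvgZ c f (a : R) (b : Y) :
  c p @[p --> F] --> a -> f p @[p --> F] --> b ->
  c p *: f p @[p --> F] --> a *: b.
Proof.
exact: (@continuous2_cvg _ R^o Y Y F FF c f (fun u v => u *: v) a b
  (@scale_continuous R Y (a, b))).
Qed.

(** A substitute for balanced neighborhoods, obtained from the continuity of
    scaling at [(0, 0)]. *)
Lemma nbhs0_scale (V : set Y) : nbhs 0 V -> exists2 d : R, 0 < d &
  exists2 W : set Y, nbhs 0 W &
    forall (a : R) w, `|a| < d -> W w -> V (a *: w).
Proof.
move=> V0; have := @scale_continuous R Y (0, 0) V.
rewrite /= scale0r => /(_ V0)[[B W] [/= /nbhs_ballP[d d0 dB] W0] BWV].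
exists d => //; exists W => // a w ad Ww; apply: (BWV (a, w)); split => //=.
by apply: dB; rewrite /ball /= sub0r normrN.
Qed.

Lemma tlmod_cvgZ_bounded c f (M : R) :
  (\forall p \near F, `|c p| <= M) -> f p @[p --> F] --> 0 ->
  c p *: f p @[p --> F] --> 0.
Proof.
move=> cM f0 V /nbhs0_scale[d d0 [W W0 WV]].
pose k := (`|M| + 1) * 2 / d.
have k0 : 0 < k by rewrite divr_gt0// mulr_gt0// ltr_wpDl.
have /(_ _ W0) kf : k *: f p @[p --> F] --> 0.
  rewrite -[X in _ --> X](scaler0 _ k).
  exact: tlmod_cvgZ (cvg_cst (k : R^o)) f0.
change (\forall p \near F, V (c p *: f p)).
near=> p.
have -> : c p *: f p = (c p / k) *: (k *: f p).
  by rewrite scalerA divfK// gt_eqF.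
apply: WV; last by near: p.
rewrite normrM normfV (gtr0_norm k0) ltr_pdivrMr//.
have : `|c p| <= M by near: p.
have := ler_norm M.
have -> : d * k = (`|M| + 1) * 2 by rewrite /k mulrC divfK ?gt_eqF.
by have := normr_ge0 M; lra.
Unshelve. all: by end_near. Qed.

End TopologicalLmodule.

(** * Derivatives along a filter *)

(** The cancellation behind the Leibniz rule, with [u = phi y *: f y],
    [v = phi y *: f x], [w = phi y *: A k], [v' = phi x *: f x],
    [w' = phi x *: A k] and [z = B k *: f x], where [y = x + k]. *)
Lemma leibniz_remainder (V : zmodType) (u v w v' w' z : V) :
  u - v - w + (v - v' - z) + (w - w') = u - v' - (w' + z).
Proof.
rewrite [u - v - w]addrAC -(addrA v) subrKA addrAC subrKA.
by rewrite opprD !addrA [u - w' - v']addrAC.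
Qed.

Section DerivativeAlong.
Context {R : realType} {X : topologicalLmodType R}.
Implicit Types (F : set_system (R * X)) (x : X).

(** What the filters of both notions of differentiability share.  A point of
    the filtered space is a pair of a scalar [t] and a direction [h];
    [vanishing_bounded] expresses that the directions are bounded. *)
Record vanishing_filter F : Prop := VanishingFilter {
  vanishing_is_filter : Filter F;
  vanishing_scalar : p.1 @[p --> F] --> (0 : R);
  vanishing_bounded : forall c : R * X -> R,
    c p @[p --> F] --> (0 : R) -> c p *: p.2 @[p --> F] --> (0 : X) }.

Definition derivative_along {Y : topologicalLmodType R} F (f : X -> Y) x
    (A : X -> Y) : Prop :=
  p.1^-1 *: (f (x + p.1 *: p.2) - f x - A (p.1 *: p.2)) @[p --> F] --> (0 : Y).

(** One derivative serves for all vanishing filters, so that it is the same for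
    the two notions of differentiability.  Derivatives are plain functions that
    are provably linear, which makes it easy to combine them. *)
Definition differentiable_scalar (phi : X -> R) : Prop :=
  forall x, exists B : X -> R^o, [/\ linear B, continuous B &
    forall F, vanishing_filter F -> derivative_along F (phi : X -> R^o) x B].

Lemma cvg_step F x : vanishing_filter F ->
  x + p.1 *: p.2 @[p --> F] --> x.
Proof.
move=> [FF t0 bF]; rewrite -[X in _ --> X]addr0.
by apply: (tlmod_cvgD FF); [exact: cvg_cst|exact: bF].
Qed.

Lemma linear_at0 (Y : topologicalLmodType R) (A : X -> Y) : linear A -> A 0 = 0.
Proof.
by move=> lA; have := lA (-1) 0 0; rewrite scaler0 addr0 scaleN1r addNr.
Qed.

Lemma linear_scale (Y : topologicalLmodType R) (A : X -> Y) (a : R) (h : X) :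
  linear A -> A (a *: h) = a *: A h.
Proof. by move=> lA; have := lA a h 0; rewrite (linear_at0 lA) !addr0. Qed.

Lemma cvg_linear_step (Y : topologicalLmodType R) F (A : X -> Y)
    (c : R * X -> R) :
  vanishing_filter F -> linear A -> continuous A ->
  c p @[p --> F] --> (0 : R) -> A (c p *: p.2) @[p --> F] --> (0 : Y).
Proof.
move=> [FF t0 bF] lA cA c0; rewrite -(linear_at0 lA).
exact: (cvg_comp _ _ (bF _ c0) (cA 0)).
Qed.

Lemma derivative_along_cvg F (phi : X -> R^o) x (B : X -> R^o) :
  vanishing_filter F -> linear B -> continuous B ->
  derivative_along F phi x B ->
  phi (x + p.1 *: p.2) - phi x @[p --> F] --> (0 : R).
Proof.
move=> vF lB cB dphi; have FF := vanishing_is_filter vF.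
have t0 := vanishing_scalar vF.
have := tlmod_cvgD FF (tlmod_cvgZ FF t0 dphi) (cvg_linear_step vF lB cB t0).
rewrite scale0r addr0; apply: eq_cvg_imp => -[t h] /=.
have [->|tN0] := eqVneq t 0.
  by rewrite !scale0r addr0 subrr (linear_at0 lB) addr0.
by rewrite scalerA divff// scale1r subrK.
Qed.

(** The Leibniz rule.  With [y = x + t *: h], the remainder of [phi *: f] is the
    sum of the remainder of [f] times [phi y], which is bounded, the remainder
    of [phi] times [f x], and [(phi y - phi x) *: A (t *: h)].  The last term,
    divided by [t], is [A] applied to [phi y - phi x] times [h], where a scalar
    that tends to [0] multiplies a bounded direction. *)
Lemma derivative_alongZ (Y : topologicalLmodType R) F (phi : X -> R^o)
    (f : X -> Y) x (B : X -> R^o) (A : X -> Y) :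
  vanishing_filter F -> linear B -> continuous B -> linear A -> continuous A ->
  derivative_along F phi x B -> derivative_along F f x A ->
  derivative_along F (fun y => phi y *: f y) x
    (fun h => phi x *: A h + B h *: f x).
Proof.
move=> vF lB cB lA cA dphi df; have FF := vanishing_is_filter vF.
have d0 := derivative_along_cvg vF lB cB dphi.
have phib : \forall p \near F, `|phi (x + p.1 *: p.2)| <= `|phi x| + 1.
  have := @cvgr0_norm_le _ R^o _ F FF _ d0 1 ltr01.
  apply: filterS => p /= H.
  rewrite -[phi (x + _)](subrK (phi x)) (le_trans (ler_normD _ _))//.
  by rewrite addrC lerD2l.
(* [p.1^-1 * p.1] is [1], except where [p.1 = 0]; there it is [0]. *)
pose c (p : R * X) : R := p.1^-1 * p.1 * (phi (x + p.1 *: p.2) - phi x).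
have c0 : c p @[p --> F] --> (0 : R).
  apply: (tlmod_cvgZ_bounded FF (Y := R^o) (M := 1) _ d0); apply: nearW => p.
  have [->|?] := eqVneq p.1 0; first by rewrite mulr0 normr0 ler01.
  by rewrite mulVf// normr1.
have fx : (fun _ : R * X => f x) p @[p --> F] --> f x by exact: cvg_cst.
have := tlmod_cvgD FF (tlmod_cvgD FF (tlmod_cvgZ_bounded FF phib df)
  (tlmod_cvgZ FF dphi fx)) (cvg_linear_step vF lA cA c0).
rewrite scale0r !addr0; apply: eq_cvg_imp => -[t h] /=; rewrite /c /=.
set y := x + t *: h.
have -> : A ((t^-1 * t * (phi y - phi x)) *: h) =
    t^-1 *: ((phi y - phi x) *: A (t *: h)).
  by rewrite -!(linear_scale _ _ lA) !scalerA; congr (A (_ *: _)); ring.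
have -> : (t^-1 *: (phi y - phi x - B (t *: h))) *: f x =
    t^-1 *: ((phi y - phi x - B (t *: h)) *: f x) by exact/esym/scalerA.
rewrite [phi y *: (_ *: _)]scalerA [phi y * _]mulrC -[(_ * phi y) *: _]scalerA.
rewrite -!scalerDr.
by congr (_ *: _); rewrite !scalerBr !scalerBl leibniz_remainder.
Qed.

Lemma cvgr0_le (T : Type) (F : set_system T) (FF : Filter F) (a b : T -> R) :
  (forall p, `|a p| <= b p) -> b p @[p --> F] --> (0 : R) ->
  a p @[p --> F] --> (0 : R).
Proof.
move=> ab b0; have nb0 : - b p @[p --> F] --> (0 : R).
  by rewrite -oppr0; exact: cvgN.
apply: squeeze_cvgr nb0 b0.
by apply: nearW => p; rewrite -ler_norml.
Qed.

Lemma cvg_sqrt_scalar F : vanishing_filter F ->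
  Num.sqrt `|p.1| @[p --> F] --> (0 : R).
Proof.
move=> [FF t0 _]; have n0 : `|p.1| @[p --> F] --> (0 : R).
  by rewrite -(normr0 R); apply: cvg_norm.
have := cvg_comp _ _ n0 (@sqrt_continuous R 0).
by rewrite /= sqrtr0.
Qed.

(** A function of class C1 that vanishes on a half-line: the cutoff functions
    are built from it by composition. *)
Definition pospart_sqr (u : R) : R := Num.max 0 u ^+ 2.

(** The Taylor bound is global and quadratic, which makes composition with
    [pospart_sqr] compatible with derivatives along an arbitrary filter. *)
Lemma pospart_sqr_remainder (u v : R) :
  `|pospart_sqr v - pospart_sqr u - 2 * Num.max 0 u * (v - u)| <= (v - u) ^+ 2.
Proof.
rewrite /pospart_sqr ler_norml.
have := sqr_ge0 u; have := sqr_ge0 v; have := sqr_ge0 (v - u).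
case: (leP 0 u) => u0; case: (leP 0 v) => v0; rewrite ?expr0n /=.
- by move=> *; apply/andP; split; nra.
- have : u * v <= 0 by rewrite mulr_ge0_le0// ltW.
  by move=> *; apply/andP; split; nra.
- have : u * v <= 0 by rewrite mulr_le0_ge0// ltW.
  by move=> *; apply/andP; split; nra.
- by move=> *; apply/andP; split; nra.
Qed.

(** The chain rule.  The error of [pospart_sqr] is at most the square of
    [phi (x + t *: h) - phi x].  Divided by [|t|], this is [w ^+ 2], where [w] is
    the difference quotient of [phi] multiplied by [sqrt |t|]; and [w] tends to
    [0] because both the rescaled remainder of [phi] and [B (sqrt |t| *: h)]
    do. *)
Lemma differentiable_scalar_pospart_sqr (phi : X -> R) :
  differentiable_scalar phi ->
  differentiable_scalar (fun x => pospart_sqr (phi x)).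
Proof.
move=> sphi x; have [B [lB cB dphi]] := sphi x.
pose k : R := 2 * Num.max 0 (phi x).
exists (fun h => k *: B h); split.
- by move=> a h h'; rewrite lB scalerDr !scalerA mulrC.
- by move=> h; exact: (tlmod_cvgZ (nbhs_filter h) (cvg_cst (k : R^o)) (cB h)).
move=> F vF; have FF := vanishing_is_filter vF; have {}dphi := dphi F vF.
pose w (p : R * X) : R :=
  Num.sqrt `|p.1| * (p.1^-1 * (phi (x + p.1 *: p.2) - phi x)).
have w0 : w p @[p --> F] --> (0 : R).
  have s0 := cvg_sqrt_scalar vF.
  have Bs : (p.1^-1 * p.1) *: B (Num.sqrt `|p.1| *: p.2) @[p --> F] -->
      (0 : R^o).
    apply: (tlmod_cvgZ_bounded FF (Y := R^o) (M := 1)).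
      apply: nearW => p; have [->|?] := eqVneq p.1 0.
        by rewrite mulr0 normr0 ler01.
      by rewrite mulVf// normr1.
    exact: cvg_linear_step.
  have := tlmod_cvgD FF (tlmod_cvgZ FF s0 dphi) Bs.
  rewrite scale0r addr0; apply: eq_cvg_imp => -[t h] /=; rewrite /w /=.
  rewrite !(linear_scale _ _ lB) /GRing.scale /=; ring.
pose e (p : R * X) : R := pospart_sqr (phi (x + p.1 *: p.2)) -
  pospart_sqr (phi x) - k * (phi (x + p.1 *: p.2) - phi x).
have e0 : p.1^-1 * e p @[p --> F] --> (0 : R).
  apply: (cvgr0_le FF (b := fun p => w p ^+ 2)); last first.
    by have := cvg_comp _ _ w0 (@exprn_continuous R 2 0); rewrite /= expr0n.
  move=> [t h]; rewrite /w /= !exprMn sqr_sqrtr// normrM.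
  have [->|tN0] := eqVneq t 0; first by rewrite invr0 normr0 !mul0r.
  rewrite mulrA (_ : `|t| * t^-1 ^+ 2 = `|t^-1|); last first.
    by rewrite -(ger0_norm (sqr_ge0 t^-1)) -normrM expr2 mulVKf.
  by rewrite ler_wpM2l// pospart_sqr_remainder.
have kc : (fun _ : R * X => k) p @[p --> F] --> (k : R^o) by exact: cvg_cst.
have := tlmod_cvgD FF (Y := R^o) (tlmod_cvgZ FF kc dphi) e0.
rewrite scaler0 addr0; apply: eq_cvg_imp => -[t h] /=; rewrite /e /=.
by rewrite /GRing.scale /=; ring.
Qed.

Lemma differentiable_scalar_affine (a b : R) (phi : X -> R) :
  differentiable_scalar phi -> differentiable_scalar (fun x => a * phi x + b).
Proof.
move=> sphi x; have [B [lB cB dphi]] := sphi x.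
exists (fun h => a *: B h); split.
- by move=> c h h'; rewrite lB scalerDr !scalerA mulrC.
- by move=> h; exact: (tlmod_cvgZ (nbhs_filter h) (cvg_cst (a : R^o)) (cB h)).
move=> F vF; have FF := vanishing_is_filter vF.
have ac : (fun _ : R * X => a) p @[p --> F] --> (a : R^o) by exact: cvg_cst.
have := tlmod_cvgZ FF ac (dphi F vF).
rewrite scaler0; apply: eq_cvg_imp => -[t h] /=.
by rewrite /GRing.scale /=; ring.
Qed.

(** For a quadratic form the remainder is [q (t *: h)]; divided by [t], it is
    equal up to sign to [q (sqrt |t| *: h)], which tends to [0]. *)
Lemma differentiable_scalar_quadratic (q : X -> R) (L : X -> X -> R^o) :
  (forall x, linear (L x)) -> (forall x, continuous (L x)) ->
  (forall x h, q (x + h) = q x + L x h + q h) ->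
  (forall a h, q (a *: h) = a ^+ 2 * q h) -> q h @[h --> 0] --> (0 : R) ->
  differentiable_scalar q.
Proof.
move=> lL cL qD qZ q0 x; exists (L x); split => // F vF.
have FF := vanishing_is_filter vF.
have qs := cvg_comp _ _ (vanishing_bounded vF (cvg_sqrt_scalar vF)) q0.
have nq : `|q (Num.sqrt `|p.1| *: p.2)| @[p --> F] --> (0 : R).
  by rewrite -(normr0 R); apply: cvg_norm; exact: qs.
apply: (cvgr0_le FF (a := fun p => _) _ nq) => -[t h] /=.
have -> : q (x + t *: h) - q x - L x (t *: h) = t ^+ 2 * q h.
  by apply/eqP; rewrite qD qZ !subr_eq addrC [q x + _]addrC addrA.
rewrite qZ sqr_sqrtr// /GRing.scale /= mulrA.
rewrite normrM [in leRHS]normrM ler_wpM2r//.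
have [->|tN0] := eqVneq t 0; first by rewrite invr0 mul0r normr0.
by rewrite expr2 mulKf// normr_id.
Qed.

End DerivativeAlong.

(** * Bump functions and the extension of germs *)

Section Extension.
Context {R : realType} {X : topologicalLmodType R}.
Implicit Types (x : X) (U : set X) (q phi : X -> R).

Definition has_differentiable_bumps : Prop := forall U, nbhs 0 U -> exists phi,
  [/\ differentiable_scalar phi, \forall x \near 0, phi x = 1 &
    forall x, ~ U x -> \forall y \near x, phi y = 0].

(** With [p := pospart_sqr] and [s := 4 / d * q x], the bump is
    [p (1 - p (s - 1))]: it is [p 1 = 1] where [s <= 1], and [0] where [2 <= s],
    since then [p (s - 1) >= 1].  The points outside [U] have [s >= 4], so that
    [2 <= s] in a neighborhood of them. *)
Lemma bumps_of_quadratic :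
  (forall U, nbhs 0 U -> exists q (L : X -> X -> R^o) (d : R),
    [/\ 0 < d, forall x, q x < d -> U x,
      (forall x, linear (L x)) /\ (forall x, continuous (L x)),
      (forall x h, q (x + h) = q x + L x h + q h) /\
      (forall a h, q (a *: h) = a ^+ 2 * q h) &
      q h @[h --> 0] --> (0 : R)]) -> has_differentiable_bumps.
Proof.
move=> H U /H[q [L [d [d0 qU [lL cL] [qD qZ] q0]]]].
have sq : differentiable_scalar q :=
  differentiable_scalar_quadratic lL cL qD qZ q0.
have cq x : q y @[y --> x] --> q x.
  have sx : y - x @[y --> x] --> (0 : X).
    have xc : (fun _ : X => - x) y @[y --> x] --> - x by exact: cvg_cst.
    by rewrite -(subrr x); exact: (tlmod_cvgD (nbhs_filter x) cvg_id xc).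
  have qx : (fun _ : X => q x) y @[y --> x] --> q x by exact: cvg_cst.
  have Lq := tlmod_cvgD (Y := R^o) (nbhs_filter x)
    (cvg_comp _ _ sx (cL x 0)) (cvg_comp _ _ sx q0).
  have := tlmod_cvgD (Y := R^o) (nbhs_filter x) qx Lq.
  rewrite (linear_at0 (lL x)) !addr0; apply: eq_cvg_imp => y /=.
  by rewrite addrA -qD addrC subrK.
pose phi x := pospart_sqr (-1 * pospart_sqr (4 / d * q x + -1) + 1).
exists phi; split.
- apply: differentiable_scalar_pospart_sqr; apply: differentiable_scalar_affine.
  apply: differentiable_scalar_pospart_sqr.
  exact: differentiable_scalar_affine.
- have : \forall x \near (0 : X), `|q x| < d / 4.
    by apply: (cvgr0_norm_lt _ q0); rewrite divr_gt0.
  apply: filterS => x; rewrite ltr_norml => /andP[_ qx].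
  rewrite /phi /pospart_sqr.
  have /max_idPl -> : 4 / d * q x + -1 <= 0.
    by rewrite subr_le0 mulrAC ler_pdivrMr// mul1r mulrC -ler_pdivlMr// ltW.
  by rewrite expr0n mulr0 add0r (max_idPr ler01) expr1n.
- move=> x Ux.
  have qx : d / 2 < q x.
    case: (ltP (q x) d) => [/qU//|]; apply: lt_le_trans.
    by rewrite ltr_pdivrMr// ltr_pMr// ltr1n.
  have : \forall y \near x, d / 2 < q y by exact: (cvgr_gt _ (cq x)).
  apply: filterS => y qy.
  rewrite /phi /pospart_sqr.
  have le1 : 1 <= 4 / d * q y + -1.
    rewrite lerBrDr mulrAC ler_pdivlMr//.
    by move: qy; rewrite ltr_pdivrMr//; lra.
  rewrite (max_idPr (le_trans ler01 le1)).
  have : 1 <= (4 / d * q y + -1) ^+ 2 by rewrite exprn_ege1.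
  move=> {}le1; rewrite (max_idPl _) ?expr0n//.
  by lra.
Qed.

(** Differentiability for a class [C] of filters on pairs of a scalar and a
    direction; bounded and compact differentiability are two instances. *)
Definition differentiable_wrt (C : set (set_system (R * X)))
    (Y : topologicalLmodType R) (D : set X) (f : X -> Y) x : Prop :=
  nbhs x D /\ exists A : {linear X -> Y}, continuous A /\
    forall F, C F -> derivative_along F f x A.

(** The bump is taken for the set of points where the representative [f] is
    differentiable. *)
Theorem germ_extension (C : set (set_system (R * X)))
    (Y : topologicalLmodType R) :
  has_differentiable_bumps -> (forall F, C F -> vanishing_filter F) ->
  forall g : germ X Y, differentiable_germ (@differentiable_wrt C Y) g ->
    has_global_representative (@differentiable_wrt C Y) g.
Proof.
move=> bumps Cv [reps [f0 repsE]] [f /= repf df].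
have [phi [sphi phi1 phi0]] := bumps _ df.
exists (@LocalMap _ _ _ setT (fun x => phi x *: f x) filterT); split => //=.
  rewrite repsE /germ_eq /=; move: repf; rewrite repsE /germ_eq /=.
  apply: filterS2 phi1 => x phix [Dx _ ->]; split => //.
  by rewrite phix scale1r.
move=> x; split; first exact: filterT.
have [[_ [A [cA dA]]]|Ux] := pselect (differentiable_wrt C (dom f) f x).
  have [B [lB cB dB]] := sphi x.
  pose A' h := phi x *: A h + B h *: f x.
  have lA' : linear A'.
    move=> a u v; rewrite /A' linearP lB !scalerDr scalerDl !scalerA.
    rewrite mulrC [X in _ = _ + _ + X]addrC addrACA -!scalerA.
    by congr (_ + _); rewrite addrC.
  pose A'l : {linear X -> Y} :=
    HB.pack A' (GRing.isLinear.Build _ _ _ _ A' lA').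
  exists A'l; split.
    move=> h; apply: (tlmod_cvgD (nbhs_filter h)).
      exact: (tlmod_cvgZ (nbhs_filter h) (cvg_cst (phi x : R^o)) (cA h)).
    exact: (tlmod_cvgZ (nbhs_filter h) (cB h) (cvg_cst (f x))).
  move=> F CF; have vF := Cv F CF.
  apply: (derivative_alongZ vF lB cB _ cA (dB _ vF) (dA F CF)).
  exact: linearP.
exists \0; split; first by move=> h; exact: cvg_cst.
move=> F CF; have FF := vanishing_is_filter (Cv F CF).
have phix := phi0 _ Ux.
have phiF : \forall p \near F, phi (x + p.1 *: p.2) = 0.
  exact: cvg_step (Cv F CF) _ phix.
apply: cvg_near_cst; near=> p; rewrite (near phiF)//.
by rewrite (nbhs_singleton phix) !scale0r subrr subr0 scaler0.
Unshelve. all: by end_near. Qed.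

End Extension.

(** * The filters of bounded and compact differentiability *)

Section TwoDifferentiabilities.
Context {R : realType} {X : topologicalLmodType R}.
Implicit Types F : set_system (R * X).

Definition bounded_filters : set (set_system (R * X)) :=
  [set F | exists S : set X, tvs_bounded S /\
    F = filter_prod (0 : R)^' (globally S)].

Definition sequential_filters : set (set_system (R * X)) :=
  [set F | exists (t_ : nat -> R) (h_ : nat -> X) (h : X),
    [/\ t_ n @[n --> \oo] --> (0 : R), h_ n @[n --> \oo] --> h &
      F = (t_ n, h_ n) @[n --> \oo]]].

(** Boundedness of [S] puts it into [r W], and [c *: (r *: w)] is small once
    [|c * r|] is. *)
Lemma bounded_filters_vanishing F : bounded_filters F -> vanishing_filter F.
Proof.
move=> [S [bS ->]]; split=> [||c c0 V].
- exact: filter_prod_filter.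
- by apply: (cvg_trans cvg_fst); exact: nbhs_dnbhs.
move=> /nbhs0_scale[d d0 [W W0 WV]]; have [r [r0 Sr]] := bS _ W0.
have : \forall p \near filter_prod (0 : R)^' (globally S), `|c p| < d / r.
  by apply: (cvgr0_norm_lt _ c0); rewrite divr_gt0.
move=> cd.
have S2 : \forall p \near filter_prod (0 : R)^' (globally S), S p.2.
  exact: (cvg_snd (F := (0 : R)^') (G := globally S)).
apply: filterS2 cd S2 => p cp /(Sr r) /=; rewrite gtr0_norm// => /(_ (lexx r)).
move=> [w Ww <-]; rewrite scalerA; apply: WV => //.
by rewrite normrM (gtr0_norm r0) -ltr_pdivlMr.
Qed.

Lemma sequential_filters_vanishing F :
  sequential_filters F -> vanishing_filter F.
Proof.
move=> [t_ [h_ [h [t0 hh ->]]]]; split=> [||c c0].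
- exact: fmap_filter.
- exact: t0.
rewrite -(scale0r h); apply: (tlmod_cvgZ (fmap_filter _ _)) => //.
Qed.

Lemma bounded_differentiable_wrt (Y : topologicalLmodType R) :
  @bounded_differentiable_at R X Y = @differentiable_wrt R X bounded_filters Y.
Proof.
apply/funext => D; apply/funext => f; apply/funext => x; apply/propext.
split=> -[Dx [A [cA dA]]]; split=> //; exists A; split=> //.
  move=> F [S [bS ->]] V /(dA S bS) H.
  exists ([set t | forall h, S h ->
    V (t^-1 *: (f (x + t *: h) - f x - A (t *: h)))], S).
    by split => //=.
  by move=> [t h] [Vt Sh]; exact: Vt h Sh.
move=> S bS V V0.
have /(_ _ V0)[[P Q] /= [P0 SQ] PQ] := dA _ (ex_intro _ S (conj bS erefl)).
by apply: filterS P0 => t Pt h Sh; apply: (PQ (t, h)); split => //=; exact: SQ.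
Qed.

(** Compact differentiability subtracts [t_ n *: A h], with the limit [h] of the
    directions, while [derivative_along] subtracts [A (t_ n *: h_ n)]; this is
    the difference of the two rescaled remainders. *)
Lemma cvg_rescaled_difference (Y : topologicalLmodType R) (t_ : nat -> R)
    (u v : nat -> Y) (a : Y) :
  u n @[n --> \oo] --> a -> v n @[n --> \oo] --> a ->
  ((t_ n)^-1 * t_ n) *: (u n - v n) @[n --> \oo] --> 0.
Proof.
move=> ua va; apply: (tlmod_cvgZ_bounded eventually_filter (M := 1)).
  apply: nearW => n; have [->|?] := eqVneq (t_ n) 0.
    by rewrite mulr0 normr0.
  by rewrite mulVf// normr1.
rewrite -(subrr a); apply: (tlmod_cvgD eventually_filter) => //.
exact: (cvg_comp _ _ va (@opp_continuous Y a)).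
Qed.

Lemma compact_differentiable_wrt (Y : topologicalLmodType R) :
  @compact_differentiable_at R X Y =
  @differentiable_wrt R X sequential_filters Y.
Proof.
apply/funext => D; apply/funext => f; apply/funext => x; apply/propext.
split=> -[Dx [A [cA dA]]]; split=> //; exists A; split=> //.
  move=> F [t_ [h_ [h [t0 hh ->]]]].
  have Ah : A (h_ n) @[n --> \oo] --> A h := cvg_comp _ _ hh (cA h).
  have Ac : (fun _ : nat => A h) n @[n --> \oo] --> A h by exact: cvg_cst.
  have := tlmod_cvgD eventually_filter (dA _ _ _ t0 hh)
    (cvg_rescaled_difference t_ Ac Ah).
  rewrite addr0; apply: eq_cvg_imp => n /=.
  rewrite [A (_ *: _)]linearZ /= -scalerA -scalerDr; congr (_ *: _).
  by rewrite scalerBr addrA subrK.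
move=> t_ h_ h t0 hh.
have Ah : A (h_ n) @[n --> \oo] --> A h := cvg_comp _ _ hh (cA h).
have Ac : (fun _ : nat => A h) n @[n --> \oo] --> A h by exact: cvg_cst.
have dF : derivative_along ((t_ n, h_ n) @[n --> \oo]) f x A.
  by apply: dA; exists t_, h_, h.
have dn : (t_ n)^-1 *: (f (x + t_ n *: h_ n) - f x - A (t_ n *: h_ n))
  @[n --> \oo] --> 0 by exact: dF.
have := tlmod_cvgD eventually_filter dn
  (cvg_rescaled_difference t_ Ah Ac).
rewrite addr0; apply: eq_cvg_imp => n /=.
rewrite [A (_ *: _)]linearZ /= -scalerA -scalerDr; congr (_ *: _).
by rewrite scalerBr addrA subrK.
Qed.

End TwoDifferentiabilities.

(** * Integration over the unit interval and the Sobolev inequality *)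

Section Integral.
Context {R : realType}.
Implicit Types (f g : unit_interval R -> R) (s t : unit_interval R).

Lemma clamp01_subproof (x : R) : Num.max 0 (Num.min x 1) \in unit_interval R.
Proof.
apply: in01; first by rewrite le_max lexx.
by rewrite ge_max ler01 ge_min lexx orbT.
Qed.

(** Composing with the retraction of the line onto [unit_interval] turns
    functions on [unit_interval] into functions on [R], to which integrals and
    derivatives apply; continuity is preserved. *)
Definition clamp01 (x : R) : unit_interval R := SigSub (clamp01_subproof x).

Lemma set_val01 t : 0 <= set_val t <= 1.
Proof.
have : unit_interval R (set_val t) by exact: set_valP.
by rewrite /unit_interval /= in_itv.
Qed.

Lemma set_val_clamp01 (x : R) : 0 <= x <= 1 -> set_val (clamp01 x) = x.
Proof.
by move=> /andP[x0 x1]; rewrite set_valE /= (min_idPl x1) (max_idPr x0).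
Qed.

Lemma clamp01K t : clamp01 (set_val t) = t.
Proof. by apply: val_inj; exact/set_val_clamp01/set_val01. Qed.

Lemma continuous_clamp01 : continuous clamp01.
Proof.
move=> x A /nbhs01P[e e0 eA].
apply/nbhs_ballP; exists e => // y xy; apply: eA.
apply: le_lt_trans xy; rewrite set_valE /=.
by case: (leP x 1) => ?; case: (leP y 1) => ?; rewrite ?(max_idPr ler01);
  case: (leP 0 x) => ?; case: (leP 0 y) => ?;
  rewrite ler_norml; case: (ger0P (x - y)) => ?; lra.
Qed.

Lemma continuous_sqr (T : topologicalType) (f : T -> R) :
  continuous f -> continuous (fun x => f x ^+ 2).
Proof.
move=> cf x; apply: (@continuous_comp _ _ _ f (fun y => y ^+ 2)).
  exact: cf.
exact: exprn_continuous.
Qed.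

Lemma continuous_comp_clamp01 f : continuous f -> continuous (f \o clamp01).
Proof.
move=> cf x; apply: continuous_comp; last exact: cf.
exact: continuous_clamp01.
Qed.

Definition int01 f : R := \int[lebesgue_measure]_(x in `[0, 1]) f (clamp01 x).

Lemma integrable_segment (a b : R) (h : R -> R) : continuous h ->
  lebesgue_measure.-integrable `[a, b] (EFin \o h).
Proof.
move=> ch; apply: continuous_compact_integrable; first exact: segment_compact.
exact: continuous_subspaceT.
Qed.

Lemma integrable_clamp01 f : continuous f ->
  lebesgue_measure.-integrable `[0, 1] (EFin \o (f \o clamp01)).
Proof.
by move=> cf; apply: integrable_segment; exact: continuous_comp_clamp01.
Qed.

Lemma int01D f g : continuous f -> continuous g ->
  int01 (fun t => f t + g t) = int01 f + int01 g.
Proof. by move=> cf cg; apply: RintegralD => //; exact: integrable_clamp01. Qed.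

Lemma int01Z (a : R) f : continuous f -> int01 (fun t => a * f t) = a * int01 f.
Proof. by move=> cf; apply: RintegralZl => //; exact: integrable_clamp01. Qed.

Lemma int01_cst (a : R) : int01 (fun=> a) = a.
Proof.
rewrite /int01 Rintegral_cst//= lebesgue_measure_itv/= lte_fin ltr01.
by rewrite -EFinB/= subr0 mulr1.
Qed.

Lemma le_int01 f g : continuous f -> continuous g ->
  (forall t, f t <= g t) -> int01 f <= int01 g.
Proof.
by move=> cf cg fg; apply: le_Rintegral => //; exact: integrable_clamp01.
Qed.

Lemma le_segment_int01 f s t : continuous f -> (forall t, 0 <= f t) ->
  \int[lebesgue_measure]_(x in `[set_val s, set_val t]) f (clamp01 x) <=
  int01 f.
Proof.
move=> cf f0; have cfc := continuous_comp_clamp01 cf.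
have /andP[s0 _] := set_val01 s; have /andP[_ t1] := set_val01 t.
have sub : `[set_val s, set_val t]%classic `<=` `[0, 1]%classic.
  by apply: subset_itv; rewrite bnd_simp.
apply: fine_le.
- exact: integrable_fin_num (integrable_segment _ _ cfc).
- exact: integrable_fin_num (integrable_segment _ _ cfc).
- apply: ge0_subset_integral => //.
    by have /measurable_int := integrable_clamp01 cf.
  by move=> x _; rewrite lee_fin.
Qed.

(** In the open interval the retraction is the identity near [x], so the
    difference quotients are the same. *)
Lemma is_derive_clamp01 f (x : R) : 0 < x < 1 ->
  cvg (diff_quot f (clamp01 x) s @[s --> (clamp01 x)^']) ->
  is_derive x 1 (f \o clamp01) (deriv01 f (clamp01 x)).
Proof.
move=> /andP[x0 x1] df.
have xE : set_val (clamp01 x) = x by rewrite set_val_clamp01// !ltW.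
suff H : h^-1 *: (((f \o clamp01) \o shift x) (h *: 1) - (f \o clamp01) x)
    @[h --> 0^'] --> deriv01 f (clamp01 x).
  apply: DeriveDef; first by apply/cvg_ex; exists (deriv01 f (clamp01 x)).
  by rewrite /derive; apply/cvg_lim.
have near01 : \forall h \near (0 : R)^', 0 < h + x < 1.
  near=> h; apply/andP.
  have : `|h| < Num.min x (1 - x).
    near: h; apply: dnbhs0_lt; rewrite lt_min x0 subr_gt0//.
  by rewrite lt_min !ltr_norml => /andP[/andP[? ?] /andP[? ?]]; split; lra.
have cl : clamp01 (h + x) @[h --> (0 : R)^'] --> (clamp01 x)^'.
  move=> A xA; change (\forall h \near (0 : R)^', A (clamp01 (h + x))).
  have {xA}/nbhs01P[e e0 eA] :
    nbhs (clamp01 x) (fun s => s != clamp01 x -> A s) by exact: xA.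
  near=> h.
  have hv : set_val (clamp01 (h + x)) = h + x.
    have /andP[? ?] : 0 < h + x < 1 by near: h.
    by rewrite set_val_clamp01// !ltW.
  have h0 : h != 0 by near: h; exact: nbhs_dnbhs_neq.
  apply: eA.
    rewrite xE hv opprD addrCA subrr addr0 normrN.
    by near: h; exact: dnbhs0_lt.
  apply/eqP => /(congr1 set_val); rewrite hv xE => /eqP.
  by rewrite -subr_eq0 addrK (negbTE h0).
have := cvg_comp _ _ cl df.
apply: cvg_trans; apply: near_eq_cvg; near=> h.
have hv : set_val (clamp01 (h + x)) = h + x.
  have /andP[? ?] : 0 < h + x < 1 by near: h.
  by rewrite set_val_clamp01// !ltW.
by rewrite /diff_quot /= hv xE addrK /GRing.scale /= mulr1 mulrC.
Unshelve. all: by end_near. Qed.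

(** The one-dimensional Sobolev inequality.  By the fundamental theorem of
    calculus, [f ^+ 2] varies by at most the integral of [2 |f f'|], hence of
    [f ^+ 2 + f' ^+ 2]; as [f s ^+ 2] is on average the integral of [f ^+ 2],
    integrating over the other end point of the variation gives the bound. *)
Lemma sobolev01 f t : (forall t, cvg (diff_quot f t s @[s --> t^'])) ->
  continuous (deriv01 f) ->
  f t ^+ 2 <= 2 * int01 (fun s => f s ^+ 2) + int01 (fun s => deriv01 f s ^+ 2).
Proof.
move=> df cdf; have cf := cvg_diff_quot_continuous df.
pose g s := f s ^+ 2 + deriv01 f s ^+ 2.
have cf2 : continuous (fun s => f s ^+ 2).
  exact: continuous_sqr cf.
have cdf2 : continuous (fun s => deriv01 f s ^+ 2).
  exact: continuous_sqr cdf.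
have cg : continuous g by move=> s; exact: (cvgD (cf2 s) (cdf2 s)).
(* [w] is the derivative of [f ^+ 2]. *)
pose w (x : R) := 2 * (f (clamp01 x) * deriv01 f (clamp01 x)).
have cw : continuous w.
  move=> x; apply: (cvgM (cvg_cst _)); exact: (cvgM
    (continuous_comp_clamp01 cf (x := x))
    (continuous_comp_clamp01 cdf (x := x))).
have ftc s s' : set_val s < set_val s' -> `|f s' ^+ 2 - f s ^+ 2| <= int01 g.
  move=> ss'.
  pose F (x : R) := f (clamp01 x) ^+ 2.
  have /andP[s0 _] := set_val01 s; have /andP[_ s1] := set_val01 s'.
  have dF x : x \in `](set_val s), (set_val s')[ -> is_derive x 1 F (w x).
    rewrite in_itv /= => /andP[sx xs].
    have x01 : 0 < x < 1 by rewrite (le_lt_trans s0)//= (lt_le_trans xs).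
    have := @is_deriveX _ _ _ 2 _ _ _ (is_derive_clamp01 x01 (df _)).
    rewrite /GRing.scale /= expr1 /F /w mulrA.
    by rewrite (_ : (f \o clamp01) ^+ 2 = F)// /F.
  have cF : continuous F.
    exact: continuous_comp_clamp01 cf2.
  have := @continuous_FTC2 R w F (set_val s) (set_val s') ss'.
  rewrite {4 5}/F !clamp01K -EFinB => FTC.
  have -> : f s' ^+ 2 - f s ^+ 2 =
      \int[lebesgue_measure]_(x in `[set_val s, set_val s']) w x.
    rewrite /Rintegral FTC//.
    - exact: continuous_subspaceT.
    - split.
      + by move=> x /dF [].
      + by apply: cvg_at_right_filter; exact: cF.
      + by apply: cvg_at_left_filter; exact: cF.
    - by move=> x /dF [_ <-]; rewrite derive1E.
  apply: (le_trans (le_normr_Rintegral _ (integrable_segment _ _ cw))) => //.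
  apply: le_trans (le_segment_int01 s s' cg _); last first.
    by move=> r; rewrite addr_ge0// sqr_ge0.
  apply: le_Rintegral => //.
  - apply: integrable_segment => x.
    by apply: continuous_comp; [exact: cw|exact: norm_continuous].
  - exact: integrable_segment (continuous_comp_clamp01 cg).
  - move=> x _; rewrite /w /g ler_norml.
    have := sqr_ge0 (f (clamp01 x) - deriv01 f (clamp01 x)).
    have := sqr_ge0 (f (clamp01 x) + deriv01 f (clamp01 x)).
    by move=> ? ?; apply/andP; split; nra.
have bnd s : f t ^+ 2 <= f s ^+ 2 + int01 g.
  case: (ltgtP (set_val s) (set_val t)) => [/ftc|/ftc|/val_inj ->].
  - by rewrite ler_norml => /andP[_]; lra.
  - by rewrite ler_norml => /andP[]; lra.
  - rewrite lerDl -(int01_cst 0); apply: le_int01 => //.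
      exact: cst_continuous.
    by move=> r; rewrite addr_ge0// sqr_ge0.
rewrite -(int01_cst (f t ^+ 2)).
apply: le_trans (le_int01 _ _ bnd) _; first exact: cst_continuous.
  by move=> s; exact: (cvgD (cf2 s) (cvg_cst _)).
rewrite int01D//; last exact: cst_continuous.
by rewrite int01_cst int01D//; lra.
Qed.

End Integral.

(** * Bump functions on the space of smooth functions *)

Section SobolevForm.
Context {R : realType}.
Implicit Types (x y z h : Cinf01 R) (j n m : nat).

Definition deriv_inner j x y : R :=
  int01 (fun t => derivn01 j x t * derivn01 j y t).

Lemma continuous_deriv_inner j x y :
  continuous (fun t => derivn01 j x t * derivn01 j y t).
Proof.
by move=> t; exact: (cvgM (smooth01_continuous (n := j) (Cinf01P x) (x := t))
  (smooth01_continuous (n := j) (Cinf01P y) (x := t))).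
Qed.

Lemma deriv_innerC j x y : deriv_inner j x y = deriv_inner j y x.
Proof.
by rewrite /deriv_inner; congr int01; apply/funext => t; rewrite mulrC.
Qed.

Lemma deriv_inner_linear j x (a : R) y z :
  deriv_inner j x (a *: y + z) = a * deriv_inner j x y + deriv_inner j x z.
Proof.
rewrite /deriv_inner -int01Z; last exact: continuous_deriv_inner.
rewrite -int01D; last exact: continuous_deriv_inner.
  congr int01; apply/funext => t.
  rewrite (_ : Cinf01_fun (a *: y + z) = a *: (y : _ -> _) + z)//.
  rewrite derivn01ZD; [|exact: Cinf01P..].
  by rewrite !fctE /GRing.scale /=; ring.
by move=> t; exact: (cvgM (cvg_cst a) (@continuous_deriv_inner j x y t)).
Qed.

Lemma deriv_inner_ge0 j x : 0 <= deriv_inner j x x.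
Proof. by apply: Rintegral_ge0 => t _; rewrite -expr2 sqr_ge0. Qed.

Lemma deriv_inner_le j n x y : (j <= n)%N ->
  `|deriv_inner j x y| <= Cnorm n x * Cnorm n y.
Proof.
move=> jn; have jn' : (j < n.+1)%N by [].
have b t : `|derivn01 j x t * derivn01 j y t| <= Cnorm n x * Cnorm n y.
  by rewrite normrM ler_pM//; exact: (derivn01_le_Cnorm (Ordinal jn')).
have cc := @continuous_deriv_inner j x y.
rewrite ler_norml; apply/andP; split.
  rewrite -(int01_cst (- _)); apply: le_int01 => //.
    exact: cst_continuous.
  by move=> t; have := b t; rewrite ler_norml => /andP[].
rewrite -(int01_cst (_ * _)); apply: le_int01 => //.
  exact: cst_continuous.
by move=> t; have := b t; rewrite ler_norml => /andP[].
Qed.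

(** The sum reaches one order beyond [m], because the Sobolev inequality costs
    one derivative. *)
Definition sobolev_form m x : R := \sum_(j < m.+2) deriv_inner j x x.

Definition sobolev_diff m x h : R^o := \sum_(j < m.+2) 2 * deriv_inner j x h.

Lemma sobolev_formD m x h :
  sobolev_form m (x + h) =
  sobolev_form m x + sobolev_diff m x h + sobolev_form m h.
Proof.
rewrite /sobolev_form /sobolev_diff -!big_split /=; apply: eq_bigr => j _.
have D u v w : deriv_inner j u (v + w) = deriv_inner j u v + deriv_inner j u w.
  by have := deriv_inner_linear j u 1 v w; rewrite scale1r mul1r.
by rewrite D !(deriv_innerC j (x + h)) !D (deriv_innerC j h x); ring.
Qed.

Lemma sobolev_formZ m (a : R) h :
  sobolev_form m (a *: h) = a ^+ 2 * sobolev_form m h.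
Proof.
have Z j u v : deriv_inner j u (a *: v) = a * deriv_inner j u v.
  exact: (linear_scale (Y := R^o) a v (deriv_inner_linear j u)).
rewrite /sobolev_form mulr_sumr; apply: eq_bigr => j _.
by rewrite Z deriv_innerC Z mulrA.
Qed.

Lemma sobolev_diff_linear m x : linear (sobolev_diff m x).
Proof.
move=> a y z; rewrite /sobolev_diff scaler_sumr -big_split /=.
by apply: eq_bigr => j _; rewrite deriv_inner_linear /GRing.scale /=; ring.
Qed.

Lemma cvg_Cnorm0 n y : Cnorm n (x - y) @[x --> y] --> (0 : R).
Proof.
apply/(cvgr0Pnorm_lt (FF := nbhs_filter y)) => e e0; exists [:: n], e.
split=> // x /= /(_ n).
by rewrite mem_seq1 eqxx ger0_norm ?Cnorm_ge0//; exact.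
Qed.

Lemma sobolev_diff_continuous m x : continuous (sobolev_diff m x).
Proof.
move=> y; pose C := \sum_(j < m.+2) 2 * Cnorm m.+1 x.
have d0 : sobolev_diff m x (z - y) @[z --> y] --> (0 : R).
  apply: (cvgr0_le (nbhs_filter y) (b := fun z => C * Cnorm m.+1 (z - y))).
    move=> z; rewrite /C mulr_suml; apply: (le_trans (ler_norm_sum _ _ _)).
    apply: ler_sum => j _; rewrite normrM ger0_norm// -mulrA ler_wpM2l//.
    by apply: deriv_inner_le; rewrite -ltnS.
  rewrite -(mulr0 C); apply: cvgM; first exact: cvg_cst.
  exact: cvg_Cnorm0.
have := tlmod_cvgD (Y := R^o) (nbhs_filter y)
  (@cvg_cst _ (sobolev_diff m x y) _ _ (nbhs_filter y)) d0.
rewrite addr0; apply: eq_cvg_imp => z.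
have := sobolev_diff_linear m x 1 (z - y) y.
by rewrite !scale1r subrK addrC.
Qed.

Lemma sobolev_form_cvg0 m : sobolev_form m h @[h --> 0] --> (0 : R).
Proof.
have c0 : Cnorm m.+1 h @[h --> 0] --> (0 : R).
  by have := @cvg_Cnorm0 m.+1 0; under eq_fun do rewrite subr0.
apply: (cvgr0_le (nbhs_filter _)
  (b := fun h => m.+2%:R * (Cnorm m.+1 h * Cnorm m.+1 h))).
  move=> h; have -> : m.+2%:R * (Cnorm m.+1 h * Cnorm m.+1 h) =
      \sum_(j < m.+2) Cnorm m.+1 h * Cnorm m.+1 h.
    by rewrite sumr_const card_ord mulr_natl.
  apply: (le_trans (ler_norm_sum _ _ _)); apply: ler_sum => j _.
  by apply: deriv_inner_le; rewrite -ltnS.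
have := tlmod_cvgZ (Y := R^o) (nbhs_filter _)
  (@cvg_cst _ (m.+2%:R : R^o) _ _ (nbhs_filter (0 : Cinf01 R)))
  (tlmod_cvgZ (Y := R^o) (nbhs_filter _) c0 c0).
by rewrite !scaler0.
Qed.

Lemma deriv_inner_le_form m j x : (j < m.+2)%N ->
  deriv_inner j x x <= sobolev_form m x.
Proof.
move=> jm; rewrite /sobolev_form (bigD1 (Ordinal jm))//= lerDl.
by apply: sumr_ge0 => i _; exact: deriv_inner_ge0.
Qed.

(** By the Sobolev inequality, the square of a derivative of order at most [m]
    is at most three times the form, hence at most [(e / 2) ^+ 2]. *)
Lemma Cnorm_lt_of_form m k x (e : R) : (k <= m)%N -> 0 < e ->
  sobolev_form m x < e ^+ 2 / 12 -> Cnorm k x < e.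
Proof.
move=> km e0 qe; apply: (@le_lt_trans _ _ (e / 2)); last first.
  by rewrite ltr_pdivrMr// ltr_pMr// ltr1n.
apply: bigmax_le => [|j _]; first by rewrite divr_ge0// ltW.
have jm : (j <= m)%N by rewrite (leq_trans _ km)// -ltnS.
apply: sup_norm01_le => [|t]; first exact: Cinf01P.
have := @sobolev01 R (derivn01 j x) t (Cinf01P x j)
  (smooth01_continuous (n := j.+1) (Cinf01P x)).
have := deriv_inner_le_form x (leqW jm : (j < m.+2)%N).
have := deriv_inner_le_form x (jm : (j.+1 < m.+2)%N).
move=> q1 q2.
rewrite -[int01 (fun s => derivn01 j x s ^+ 2)]/(deriv_inner j x x).
rewrite -[int01 (fun s => deriv01 _ s ^+ 2)]/(deriv_inner j.+1 x x).
move=> q3; rewrite -ler_sqr ?nnegrE ?divr_ge0 ?(ltW e0)//.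
rewrite real_normK ?num_real// (le_trans q3)// expr_div_n.
by move: qe q1 q2; nra.
Qed.

Theorem Cinf01_differentiable_bumps : has_differentiable_bumps (X := Cinf01 R).
Proof.
apply: bumps_of_quadratic => U [K [e [e0 KU]]].
pose m := (\max_(k <- K) k)%N.
exists (sobolev_form m), (sobolev_diff m), (e ^+ 2 / 12); split.
- by rewrite divr_gt0// exprn_gt0.
- move=> x xq; apply: KU => k kK; rewrite subr0.
  by apply: Cnorm_lt_of_form xq => //; apply: leq_bigmax_seq.
- by split=> x; [exact: sobolev_diff_linear|exact: sobolev_diff_continuous].
- by split=> *; [exact: sobolev_formD|exact: sobolev_formZ].
- exact: sobolev_form_cvg0.
Qed.

End SobolevForm.

Theorem corollary5p5 (R : realType) (Y : topologicalLmodType R) :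
  (forall g : germ (Cinf01 R) Y,
     differentiable_germ bounded_differentiable_at g ->
     has_global_representative bounded_differentiable_at g) /\
  (forall g : germ (Cinf01 R) Y,
     differentiable_germ compact_differentiable_at g ->
     has_global_representative compact_differentiable_at g).
Proof.
rewrite bounded_differentiable_wrt compact_differentiable_wrt.
split; apply: (germ_extension Cinf01_differentiable_bumps).
  exact: bounded_filters_vanishing.
exact: sequential_filters_vanishing.
Qed.
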